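(* Let $k$ and $N$ be positive integers and let $Y$ be a positive real number. Let $I_k(N,Y)$ denote the number of integer quadruples $(n_1,n_2,u_1,u_2)$ with $$1\leqslant n_1,n_2\leqslant N,\quad 1\leqslant u_1\leqslant n_1^k,\quad 1\leqslant u_2\leqslant n_2^k,$$ satisfying $$\left|\frac{u_1}{n_1^k}-\frac{u_2}{n_2^k}\right|\leqslant \frac{1}{Y}.$$ Then $$I_k(N,Y)\ll \left(\frac{N^{2k+2}}{Y}+N^{k+1}\right)N^{o(1)}.$$
   Context: The notation $A\ll B$ means $|A|\leqslant cB$ for a constant $c$ (which may depend on $k$); $N^{o(1)}$ denotes a factor $N^{\delta(N)}$ with $\delta(N)\to 0$ as $N\to\infty$ (depending on $k$ only), uniformly in $Y$. *)

(* Defs.v *)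
From HB Require Import structures.
From mathcomp Require Import all_boot all_order all_algebra.
From mathcomp Require Import all_classical all_reals all_analysis.

Set Implicit Arguments.
Unset Strict Implicit.
Unset Printing Implicit Defensive.

Import Order.TTheory GRing.Theory Num.Theory.
Import numFieldNormedType.Exports.

Local Open Scope ring_scope.

(* A quadruple is encoded as ((n1, n2), (u1, u2)). The ordinal types only make
   the ambient type finite: n <= N and u <= n ^ k give u <= N ^ k, so no
   admissible quadruple is left out. *)
Definition close_fractions (R : realType) (k N : nat) (Y : R) :
    {set ('I_N.+1 * 'I_N.+1) * ('I_(N ^ k).+1 * 'I_(N ^ k).+1)} :=
  [set q : ('I_N.+1 * 'I_N.+1) * ('I_(N ^ k).+1 * 'I_(N ^ k).+1) |
    let: ((n1, n2), (u1, u2)) := q in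
    [&& (1 <= n1 <= N)%N, (1 <= n2 <= N)%N,
        (1 <= u1 <= n1 ^ k)%N, (1 <= u2 <= n2 ^ k)%N &
        `| (u1%:R : R) / n1%:R ^+ k - u2%:R / n2%:R ^+ k | <= 1 / Y]].

Definition I_count (R : realType) (k N : nat) (Y : R) : nat :=
  #|close_fractions k N Y|.

(* Main.v *)
Require Import Defs.
From HB Require Import structures.
From mathcomp Require Import all_boot all_order all_algebra.
From mathcomp Require Import all_classical all_reals all_analysis.
From mathcomp Require Import zify ring lra.

(* For fixed n1, n2 put a = n1^k, b = n2^k. The integer u1 b - u2 a is a multiple
   of gcd(a, b) of absolute value at most ab/Y, and each such multiple comes from
   at most gcd(a, b) pairs (u1, u2); hence there are at most
   2ab/Y + gcd(n1, n2)^k pairs. Bounding gcd(n1, n2)^k by the sum of d^k over the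
   common divisors d, the second term contributes at most
   sum_d d^k (N/d)^2 <= N^(k+1) sum_d 1/d <= N^(k+1) (1 + ln N), and
   1 + ln N <= N^delta(N) with delta(N) = 2 / sqrt (ln N). *)

Set Implicit Arguments.
Unset Strict Implicit.
Unset Printing Implicit Defensive.

Import Order.TTheory GRing.Theory Num.Theory.
Import numFieldNormedType.Exports.

(** After division by [g] the cofactors [a'] and [b'] are coprime, and powers of coprime numbers
    stay coprime. *)
Lemma gcdnXn (a b k : nat) : gcdn (a ^ k) (b ^ k) = gcdn a b ^ k.
Proof.
have [->|a0] := posnP a.
  by case: k => [|k]; rewrite ?expn0 ?gcdnn // exp0n // !gcd0n.
set g := gcdn a b; have g0 : 0 < g by rewrite gcdn_gt0 a0.
have /dvdnP[a' Ea] := dvdn_gcdl a b; have /dvdnP[b' Eb] := dvdn_gcdr a b.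
rewrite -/g in Ea Eb.
have cop : coprime a' b'.
  by rewrite /coprime -(eqn_pmul2r g0) muln_gcdl -Ea -Eb mul1n.
rewrite Ea Eb !expnMn -muln_gcdl.
by have /eqP -> := coprimeXl k (coprimeXr k cop); rewrite mul1n.
Qed.

Lemma eqn_modMr (m n x y : nat) : coprime m n ->
  (x * n == y * n %[mod m]) = (x == y %[mod m]).
Proof.
move=> cop; wlog le_yx : x y / y <= x.
  by move=> W; case/orP: (leq_total y x) => /W // ; rewrite eq_sym => ->; rewrite eq_sym.
by rewrite !eqn_mod_dvd ?leq_mul2r ?le_yx ?orbT // -mulnBl Gauss_dvdl.
Qed.

(* Writing a = g a', b = g b', the map (u, v) |-> (u b' - v a', (u - 1) / a') is
   injective: equal first components force u = u' mod a'. *)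
Lemma card_small_cross_diff (K a b m : nat) : 0 < a -> 0 < b ->
  #|[set w : 'I_K * 'I_K | [&& 0 < w.1 <= a, w.1 * b <= w.2 * a + m
      & w.2 * a <= w.1 * b + m]]| <= m.*2 + gcdn a b.
Proof.
move=> a0 b0; set g := gcdn a b; set S := [set w | _].
have g0 : 0 < g by rewrite gcdn_gt0 a0.
have /dvdnP[a' Ea] := dvdn_gcdl a b; have /dvdnP[b' Eb] := dvdn_gcdr a b.
rewrite -/g in Ea Eb.
have a'0 : 0 < a' by move: a0; rewrite Ea muln_gt0 => /andP[].
have b'0 : 0 < b' by move: b0; rewrite Eb muln_gt0 => /andP[].
have cop : coprime a' b'.
  by rewrite /coprime -(eqn_pmul2r g0) muln_gcdl -Ea -Eb mul1n.
(* Both sides of the cross inequality are multiples of [g] up to [m], so dividing by [g] replaces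
   [m] by its integer quotient. *)
pose q := m %/ g.
have divq x y : (x * g <= y * g + m) = (x <= y + q).
  by rewrite -!leq_subLR -mulnBl leq_divRL.
(* The shift by [q] puts the first component in [0, 2q]; the second is below [g] because u <= a = g
   a'. The form [g.-1.+1] of [g] is the successor that [inord] needs. *)
pose f (w : 'I_K * 'I_K) : 'I_q.*2.+1 * 'I_g.-1.+1 :=
  (inord (w.1 * b' + q - w.2 * a'), inord (w.1.-1 %/ a')).
have SE w : w \in S -> [/\ 0 < w.1 <= a, w.1 * b' <= w.2 * a' + q & w.2 * a' <= w.1 * b' + q].
  rewrite inE => /and3P[-> h1 h2]; split=> //; rewrite -divq; [move: h1|move: h2];
    by rewrite Ea Eb !mulnA.
have f_inj : {in S &, injective f}.
  move=> [u v] [u' v'] /SE /= [/andP[u0 ua] h1 h2] /SE /= [/andP[u'0 u'a] h1' h2'].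
  have lt_div x : 0 < x <= a -> x.-1 %/ a' < g.-1.+1.
    move=> /andP[x0 xa]; rewrite prednK // ltn_divLR // mulnC -Ea; lia.
  case=> /(congr1 val) /=; rewrite !inordK ?ltnS; try lia.
  move=> e1 /(congr1 val) /=; rewrite !inordK ?lt_div ?u0 ?u'0 // => e2.
  (* By [h2] and [h2'] the subtractions in [f] do not truncate, so they can be moved across. *)
  have {}e1 : u * b' + v' * a' = u' * b' + v * a' by lia.
  have e3 : u = u' %[mod a'].
    apply/eqP; rewrite -(eqn_modMr _ _ cop).
    by rewrite -(modnMDl v' (u * b')) addnC e1 addnC modnMDl.
  have e4 : u.-1 = u'.-1 %[mod a'].
    by apply/eqP; rewrite -(eqn_modDr 1) !addn1 !prednK // e3.
  have uu : u = u'.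
    apply/val_inj; rewrite /= -(prednK u0) -(prednK u'0) (divn_eq u.-1 a') e2 e4.
    by rewrite -divn_eq.
  subst u'; congr pair; apply/val_inj/eqP; rewrite -(eqn_pmul2r a'0) /=.
  by apply/eqP; lia.
(* The codomain has (2q + 1) g elements, and q g <= m. *)
rewrite -(card_in_imset f_inj); apply: leq_trans (max_card _) _.
rewrite card_prod !card_ord prednK //.
have := leq_trunc_div m g; rewrite -/q; nia.
Qed.

(** The square of [N %/ d] counts the pairs of multiples of [d] up to [N]. After exchanging sums,
    each (x, y) receives d^k for every common divisor d, and the term d = gcd(x, y) alone
    suffices. *)
Lemma sum_gcdX_le (N k : nat) :
  \sum_(1 <= x < N.+1) \sum_(1 <= y < N.+1) gcdn x y ^ k <=
  \sum_(1 <= d < N.+1) d ^ k * (N %/ d) ^ 2.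
Proof.
under [leqRHS]eq_bigr => d _.
  rewrite -mulnn !divn_count_dvd big_distrl big_distrr /=.
  under eq_bigr => x _ do rewrite big_distrr big_distrr /=.
  over.
rewrite [leqRHS]exchange_big /= !big_seq; apply: leq_sum => x.
rewrite mem_index_iota => /andP[x0 xN].
rewrite exchange_big /= !big_seq; apply: leq_sum => y _.
have g0 : 0 < gcdn x y by rewrite gcdn_gt0 x0.
have gN : gcdn x y < N.+1 by apply: leq_ltn_trans xN; rewrite dvdn_leq ?dvdn_gcdl.
rewrite (bigD1_seq (gcdn x y)) ?mem_index_iota ?g0 ?iota_uniq //=.
by rewrite dvdn_gcdl dvdn_gcdr !muln1 leq_addr.
Qed.

(** The left side is d^(k-1) (d floor(N/d))^2, which is at most N^(k-1) N^2 for d <= N and vanishes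
    beyond. The spare factor d produces the harmonic sum. *)
Lemma divisor_term_le (N k d : nat) : 0 < k -> d ^ k * (N %/ d) ^ 2 * d <= N ^ k.+1.
Proof.
case: k => // k _.
have [dN|Nd] := leqP d N; last by rewrite divn_small // muln0.
have -> : d ^ k.+1 * (N %/ d) ^ 2 * d = d ^ k * (N %/ d * d) ^ 2.
  by rewrite expnMn expnS; nia.
rewrite -[k.+2]addn2 expnD leq_mul //; first by case: k => // k; rewrite leq_exp2r.
by rewrite leq_exp2r // leq_trunc_div.
Qed.

Local Open Scope classical_set_scope.
Local Open Scope ring_scope.

Lemma harmonic_le_ln (R : realType) (N : nat) : (0 < N)%N ->
  \sum_(1 <= d < N.+1) d%:R^-1 <= 1 + ln N%:R :> R.
Proof.
elim: N => // -[_ _|n IH _]; first by rewrite big_nat1 invr1 ln1 addr0.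
rewrite big_nat_recr //=; apply: le_trans (lerD (IH isT) (lexx _)) _.
have n1 : 0 < n.+1%:R :> R by rewrite ltr0n.
have n2 : 0 < n.+2%:R :> R by rewrite ltr0n.
(* The increment 1/(n+2) is at most ln((n+2)/(n+1)), by ln(1 + t) <= t at t = -1/(n+2). *)
rewrite -addrA lerD2l -lerBrDl -opprB lerNr -ln_div ?posrE //.
have -> : n.+1%:R / n.+2%:R = 1 + - n.+2%:R^-1 :> R.
  by move: n2; rewrite -[n.+2%:R]natr1 => n2; field; lra.
by apply: le_ln1Dx; rewrite ltrN2 invf_lt1 // ltr1n.
Qed.

(** With s = sqrt(ln N) the right side is exp(2s) >= 1 + (2s)^2/2 >= 1 + s^2. For N = 1 the exponent
    is the default 2/0 = 0, harmless since the base is 1. *)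
Lemma one_add_ln_le_powR (R : realType) (N : nat) : (0 < N)%N ->
  1 + ln N%:R <= N%:R `^ (2 / Num.sqrt (ln N%:R)) :> R.
Proof.
case: N => // -[_|n _]; first by rewrite ln1 addr0 powR1.
have lpos : 0 < ln n.+2%:R :> R by rewrite ln_gt0 // ltr1n.
set L := ln _ in lpos *.
have s0 : 0 < Num.sqrt L by rewrite sqrtr_gt0.
have -> : n.+2%:R = expR L by rewrite lnK // posrE ltr0n.
rewrite -expRM -{1 2}(sqr_sqrtr (ltW lpos)).
have -> : Num.sqrt L ^+ 2 * (2 / Num.sqrt L) = 2 * Num.sqrt L by field; lra.
apply: le_trans (expR_ge1Dxn 1 _); last by lra.
by rewrite (_ : 2`!%:R = 2) //; nra.
Qed.

Lemma cvg_invr_sqrt_ln (R : realType) :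
  (2 / Num.sqrt (ln n%:R) : R) @[n --> \oo] --> (0 : R).
Proof.
apply/cvgrPdist_le => e e0; near=> n.
(* This threshold amounts to sqrt(ln n) >= 2/e. *)
have nbig : expR ((2 / e) ^+ 2) <= n%:R :> R by near: n; exact: nbhs_infty_ger.
have n0 : 0 < n%:R :> R by apply: lt_le_trans nbig; exact: expR_gt0.
have le_ln : (2 / e) ^+ 2 <= ln n%:R by rewrite -ler_expR lnK.
have e2 : 0 < 2 / e by rewrite divr_gt0.
have le_s : 2 / e <= Num.sqrt (ln n%:R).
  by rewrite -(ger0_norm (ltW e2)) -sqrtr_sqr ler_wsqrtr.
have s0 := lt_le_trans e2 le_s.
rewrite sub0r normrN ger0_norm ?divr_ge0 ?sqrtr_ge0 //.
by rewrite ler_pdivrMr // mulrC -ler_pdivrMr.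
Unshelve. all: by end_near.
Qed.

Lemma sum_gcdX_le_ln (R : realType) (N k : nat) : (0 < k)%N -> (0 < N)%N ->
  (\sum_(1 <= x < N.+1) \sum_(1 <= y < N.+1) gcdn x y ^ k)%:R
    <= N%:R ^+ k.+1 * (1 + ln N%:R) :> R.
Proof.
move=> k0 N0; apply: (@le_trans _ _ (N%:R ^+ k.+1 * \sum_(1 <= d < N.+1) d%:R^-1)); last first.
  by rewrite ler_wpM2l ?exprn_ge0 // harmonic_le_ln.
apply: (@le_trans _ _ (\sum_(1 <= d < N.+1) d ^ k * (N %/ d) ^ 2)%:R).
  by rewrite ler_nat sum_gcdX_le.
rewrite natr_sum big_distrr !big_seq /=; apply: ler_sum => d.
rewrite mem_index_iota => /andP[d0 _].
by rewrite ler_pdivlMr ?ltr0n // -natrX -natrM ler_nat divisor_term_le.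
Qed.

(** Clearing denominators gives |ub - va| <= ab/Y, and an integer bound may be rounded down. The two
    inequalities express the absolute value within [nat]. *)
Lemma close_fraction_cross (R : realType) (a b u v : nat) (Y : R) :
  (0 < a)%N -> (0 < b)%N -> 0 < Y ->
  `|u%:R / a%:R - v%:R / b%:R| <= 1 / Y ->
  let m := Num.truncn ((a * b)%:R / Y) in
  (u * b <= v * a + m)%N /\ (v * a <= u * b + m)%N.
Proof.
move=> a0 b0 Y0 + m.
have a0' : 0 < a%:R :> R by rewrite ltr0n.
have b0' : 0 < b%:R :> R by rewrite ltr0n.
have Z0 : 0 <= (a * b)%:R / Y by rewrite divr_ge0 // ltW.
have -> : u%:R / a%:R - v%:R / b%:R = (u%:R * b%:R - v%:R * a%:R) / (a * b)%:R :> R.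
  by rewrite natrM; field; lra.
rewrite normrM [X in _ * X]ger0_norm ?invr_ge0 // ler_pdivrMr ?ltr0n ?muln_gt0 ?a0 //.
rewrite mul1r (mulrC Y^-1) ler_norml => /andP[h1 h2].
rewrite -!leq_subLR; split; rewrite truncn_ge_nat //.
  have [le|/ltnW] := leqP (v * a) (u * b); first by rewrite natrB // (natrM _ u) natrM.
  by rewrite -subn_eq0 => /eqP ->.
have [le|/ltnW] := leqP (u * b) (v * a); last by rewrite -subn_eq0 => /eqP ->.
by rewrite natrB // (natrM _ v) (natrM _ u); lra.
Qed.

Lemma I_count_le_sum (R : realType) (k N : nat) (Y : R) : 0 < Y ->
  (I_count k N Y <= \sum_(1 <= x < N.+1) \sum_(1 <= y < N.+1)
     ((Num.truncn ((x ^ k * y ^ k)%:R / Y)).*2 + gcdn x y ^ k))%N.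
Proof.
move=> Y0.
(* The quadruples are fibred over (n1, n2). *)
have -> : I_count k N Y = (\sum_(x < N.+1) \sum_(y < N.+1)
    #|[pred w | ((x, y), w) \in close_fractions k N Y]|)%N.
  rewrite pair_bigA /I_count -sum1_card /=.
  under [RHS]eq_bigr => p _ do rewrite -sum1_card.
  rewrite pair_big_dep /=; apply: eq_bigl => -[[x y] w].
  by rewrite unfold_in.
(* Ordinals start at 0, where the fibres are empty; setting [F] to 0 there lets the sums start at
   1. *)
pose F x y := if (0 < x)%N && (0 < y)%N then
  ((Num.truncn ((x ^ k * y ^ k)%:R / Y)).*2 + gcdn x y ^ k)%N else 0%N.
apply: (@leq_trans (\sum_(x < N.+1) \sum_(y < N.+1) F x y)).
  apply: leq_sum => x _; apply: leq_sum => y _; rewrite /F.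
  case: ifPn => [/andP[x0 y0]|nxy].
    rewrite -gcdnXn.
    apply: leq_trans (card_small_cross_diff (N ^ k).+1 _ _ _); rewrite ?expn_gt0 ?x0 ?y0 //.
    apply/subset_leq_card/fintype.subsetP => -[u v].
    rewrite !inE /= => /and5P[_ _ u0 v0]; rewrite u0 -!natrX.
    by move=> close /=; apply/andP; apply: close_fraction_cross => //; rewrite expn_gt0 ?x0 ?y0.
  rewrite leqn0; apply/eqP/eq_card0 => -[u v].
  by rewrite !inE; apply: contraNF nxy => /and5P[/andP[-> _] /andP[-> _] _ _ _].
have F0 x y : (x == 0) || (y == 0) -> F x y = 0%N by rewrite /F; case: x y => [|x] [].
rewrite -(big_mkord xpredT (fun x => \sum_(y < N.+1) F x y)%N) big_ltn //.
rewrite big1 ?add0n; last by move=> y _; rewrite F0.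
rewrite !big_seq leq_sum // => x; rewrite mem_index_iota => /andP[x0 _].
rewrite -(big_mkord xpredT (F x)) big_ltn // F0 ?orbT // add0n.
rewrite !big_seq leq_sum // => y; rewrite mem_index_iota => /andP[y0 _].
by rewrite /F x0 y0.
Qed.

Theorem theorem2p1 (R : realType) (k : nat) (hk : (0 < k)%N) :
  exists (c : R) (delta : nat -> R),
    [/\ 0 < c,
        delta @ \oo --> (0 : R) &
        forall (N : nat) (Y : R), (0 < N)%N -> 0 < Y ->
          (I_count k N Y)%:R <=
            c * (N%:R ^+ (2 * k + 2) / Y + N%:R ^+ (k + 1))
              * N%:R `^ delta N].
Proof.
(* The constant 2 comes from the two signs of the cross difference, that is from [m.*2]. *)
exists 2, (fun n => 2 / Num.sqrt (ln n%:R)); split => //.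
  exact: cvg_invr_sqrt_ln.
move=> N Y N0 Y0; rewrite -mulrA.
have [N1 ln0] : 1 <= N%:R :> R /\ 0 <= ln N%:R :> R.
  by rewrite ln_ge0 ler1n N0.
set A := N%:R ^+ (2 * k + 2) / Y; set B := N%:R ^+ (k + 1).
have A0 : 0 <= A by rewrite divr_ge0 ?exprn_ge0 // ltW.
have B0 : 0 <= B by rewrite exprn_ge0.
apply: (@le_trans _ _ (2 * A + B * (1 + ln N%:R))); last first.
  apply: (@le_trans _ _ (2 * ((A + B) * (1 + ln N%:R)))); first by nra.
  by rewrite ler_pM2l // ler_wpM2l ?one_add_ln_le_powR // addr_ge0.
have le_I := I_count_le_sum k N Y0.
apply: le_trans (_ : _ <= (\sum_(_ <= _ < _) _)%:R) _; first by rewrite ler_nat; exact: le_I.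
under eq_bigr => x _ do rewrite big_split /=.
rewrite big_split /= natrD lerD //; last by rewrite /B addn1 sum_gcdX_le_ln.
(* Each x^k y^k is at most N^(2k), and the N^2 pairs supply the remaining factor of [A]. *)
apply: (@le_trans _ _ (\sum_(1 <= x < N.+1) \sum_(1 <= y < N.+1) 2 * (N%:R ^+ (2 * k) / Y))).
  rewrite natr_sum !big_seq; apply: ler_sum => x; rewrite mem_index_iota => /andP[x0 xN].
  rewrite natr_sum !big_seq; apply: ler_sum => y; rewrite mem_index_iota => /andP[y0 yN].
  rewrite -mul2n natrM ler_pM2l //.
  apply: (@le_trans _ _ ((x ^ k * y ^ k)%:R / Y)).
    by rewrite truncn_le divr_ge0 // ltW.
  rewrite ler_pM2r ?invr_gt0 // -natrX ler_nat mul2n -addnn expnD.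
  by rewrite leq_mul // leq_exp2r.
rewrite !sumr_const_nat subn1 /= -!mulrnA -[leLHS]mulr_natr natrM /A exprD.
by rewrite -subr_ge0 le_eqVlt; apply/orP; left; apply/eqP; ring.
Qed.
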